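(* Let $\mathcal{X}$ be a Polish space with its Borel $\sigma$-algebra, and let $\mathcal{P}$ and $\mathcal{P}_n$ ($n\ge 1$) be nonempty, weakly compact, convex sets of Borel probability measures on $\mathcal{X}$. If $\lim_{n\to\infty}\overline{\mathrm{KL}}(\mathcal{P}_n,\mathcal{P})=0$, then (i) $\lim_{n\to\infty}V(\mathcal{P}_n,\mathcal{P})=0$; (ii) $\lim_{n\to\infty}\mathrm{JS}(\mathcal{P}_n,\mathcal{P})=0$.
   Context: ''Weakly compact'' means compact in the topology of weak convergence of probability measures. For probability measures $\mu,\nu$: $\mathrm{KL}(\mu\parallel\nu)=\int_{\mathcal{X}}\log\left(\frac{d\mu}{d\nu}\right)d\mu$ (natural logarithm) if $\mu\ll\nu$, and $+\infty$ otherwise; $V(\mu,\nu)=\sup_{A}|\mu(A)-\nu(A)|$ over Borel sets $A$. For sets of probability measures: $\mathrm{KL}(\mathcal{P}\parallel\mathcal{Q}):=\sup_{\mu\in\mathcal{P}}\inf_{\nu\in\mathcal{Q}}\mathrm{KL}(\mu\parallel\nu)$ (extended-real valued); $\overline{\mathrm{KL}}(\mathcal{P},\mathcal{Q}):=\mathrm{KL}(\mathcal{P}\parallel\mathcal{Q})+\mathrm{KL}(\mathcal{Q}\parallel\mathcal{P})$; $V(\mathcal{P},\mathcal{Q}):=\max\left(\sup_{\mu\in\mathcal{P}}\inf_{\nu\in\mathcal{Q}}V(\mu,\nu),\ \sup_{\nu\in\mathcal{Q}}\inf_{\mu\in\mathcal{P}}V(\mu,\nu)\right)$; $\mathrm{JS}(\mathcal{P},\mathcal{Q}):=\frac12\mathrm{KL}(\mathcal{P}\parallel\mathcal{M})+\frac12\mathrm{KL}(\mathcal{Q}\parallel\mathcal{M})$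 with $\mathcal{M}=\left\{\frac{\mu+\nu}{2}:\mu\in\mathcal{P},\nu\in\mathcal{Q}\right\}$. *)

(* Defs.v *)
From HB Require Import structures.
From mathcomp Require Import all_boot all_order all_algebra.
From mathcomp Require Import interval_inference.
From mathcomp Require Import all_classical all_reals all_analysis.
Set Implicit Arguments.
Unset Strict Implicit.
Unset Printing Implicit Defensive.
Import Order.TTheory GRing.Theory Num.Theory.
Import numFieldNormedType.Exports.
Local Open Scope classical_set_scope.
Local Open Scope ring_scope.

Definition separable (X : topologicalType) :=
  exists2 D : set X, countable D & dense D.

Section polish.
Variables (R : realType) (X : topologicalType).

Definition is_metric (d : X -> X -> R) :=
  [/\ forall x y, 0 <= d x y,
      forall x y, d x y = 0 <-> x = y,
      forall x y, d x y = d y x &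
      forall x y z, d x z <= d x y + d y z].

Definition metric_induces_topology (d : X -> X -> R) :=
  forall (x : X) (A : set X),
    nbhs x A <-> exists2 e : R, 0 < e & [set y | d x y < e] `<=` A.

Definition metric_complete (d : X -> X -> R) :=
  forall u : nat -> X,
    (forall e : R, 0 < e -> exists N : nat,
       forall m n : nat, (N <= m)%N -> (N <= n)%N -> d (u m) (u n) < e) ->
    exists x : X, u @ \oo --> x.

Definition polish := separable X /\
  exists d : X -> X -> R,
    [/\ is_metric d, metric_induces_topology d & metric_complete d].

End polish.

(* Borel probability measures on X are the elements of [probability (borel X) R].
   Such an element is a function on all subsets of X whose values are only
   meaningful on Borel sets: expectations, KL and TV depend on no others, so a
   set of measures is represented by the set of all functions extending them. *)
Definition borel (X : ptopologicalType) : measurableType _ :=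
  g_sigma_algebraType (@open X).

Section weak_convergence.
Variables (R : realType) (X : ptopologicalType).

Definition bounded_continuous :=
  {f : X -> R | continuous f /\ exists M : R, forall x, `|f x| <= M}.

Definition expectations (mu : probability (borel X) R) :
    {ptws bounded_continuous -> R} :=
  fun f => \int[mu]_x (sval f x).

(* The topology of weak convergence: the coarsest one making
   mu |-> \int f dmu continuous for every bounded continuous f. *)
Definition weak_topology := initial_topology expectations.

Definition weakly_compact (P : set (probability (borel X) R)) :=
  compact (P : set weak_topology).

End weak_convergence.

Section mixture.
Context d (T : measurableType d) (R : realType).
Local Open Scope ereal_scope.
Variables (t : {i01 R}) (mu nu : probability T R).

Definition mixture (A : set T) : \bar R :=
  t%:num%:E * mu A + (1 - t%:num)%:E * nu A.

Let onem_ge0 : (0 <= 1 - t%:num)%R.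
Proof. by rewrite subr_ge0 le1. Qed.

Let mixtureE : mixture =
  measure_add (mscale (NngNum (ge0 t)) mu) (mscale (NngNum onem_ge0) nu).
Proof. by apply/funext => A; rewrite measure_addE. Qed.

Let mixture0 : mixture set0 = 0.
Proof. by rewrite /mixture !measure0 !mule0 adde0. Qed.

Let mixture_ge0 A : 0 <= mixture A.
Proof. by rewrite /mixture adde_ge0 ?mule_ge0 ?lee_fin ?onem_ge0. Qed.

Let mixture_sigma_additive : semi_sigma_additive mixture.
Proof. rewrite mixtureE; exact: measure_semi_sigma_additive. Qed.

HB.instance Definition _ := isMeasure.Build _ _ _ mixture
  mixture0 mixture_ge0 mixture_sigma_additive.

Let mixture_setT : mixture setT = 1.
Proof. by rewrite /mixture !probability_setT !mule1 -EFinD addrC subrK. Qed.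

HB.instance Definition _ := Measure_isProbability.Build _ _ _ mixture
  mixture_setT.

End mixture.

Section half.
Variable R : realType.

Let half_ge0 : 0 <= 2^-1 :> R. Proof. by rewrite invr_ge0. Qed.

Let half_le1 : 2^-1 <= 1 :> R. Proof. by rewrite invf_le1// ler1n. Qed.

Definition half01 : {i01 R} := Itv01 half_ge0 half_le1.

End half.

Section divergences.
Context d (T : measurableType d) (R : realType).
Implicit Types (mu nu : probability T R) (P Q : set (probability T R)).
Local Open Scope ereal_scope.

Definition convex_probabilities P :=
  forall (t : {i01 R}) mu nu, P mu -> P nu -> P (mixture t mu nu).

(* [lne] is -oo on nonpositive arguments; d mu / d nu > 0 holds mu-a.e., and the
   negative part of the integrand is mu-integrable, so the integral is never an
   indeterminate +oo - oo. *)
Definition KL mu nu : \bar R :=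
  if `[< mu `<< nu >] then
    \int[mu]_x lne (Radon_Nikodym (charge_of_finite_measure mu) nu x)
  else +oo.

Definition TV mu nu : \bar R :=
  ereal_sup [set `|mu A - nu A| | A in measurable].

Definition set_KL P Q : \bar R :=
  ereal_sup [set ereal_inf [set KL mu nu | nu in Q] | mu in P].

Definition sym_KL P Q : \bar R := set_KL P Q + set_KL Q P.

Definition set_TV P Q : \bar R :=
  maxe (ereal_sup [set ereal_inf [set TV mu nu | nu in Q] | mu in P])
       (ereal_sup [set ereal_inf [set TV mu nu | mu in P] | nu in Q]).

Definition midpoints P Q : set (probability T R) :=
  [set (mixture (half01 R) mu nu : probability T R) | mu in P & nu in Q].

Definition set_JS P Q : \bar R :=
  (2^-1)%R%:E * set_KL P (midpoints P Q) + (2^-1)%R%:E * set_KL Q (midpoints P Q).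

End divergences.

(* Main.v *)
Require Import Defs.
From mathcomp Require Import all_boot all_order all_algebra.
From mathcomp Require Import interval_inference ring lra.
From mathcomp Require Import all_classical all_reals all_analysis.
From mathcomp Require Import measurable_realfun.
Import Order.TTheory GRing.Theory Num.Theory.
Import numFieldNormedType.Exports.
Local Open Scope classical_set_scope.
Local Open Scope ring_scope.

(** Both limits follow from two inequalities between individual measures.

    A weak form of Pinsker's inequality, [TV_le_of_KL_le], gives
    [TV mu nu ^ 2 <= 8 KL mu nu].  It comes from the linearised
    Donsker-Varadhan bound [gibbs_variational_le_KL]: integrating
    [ln y >= 1 - 1/y] at [y = h e^-g], where [h] is the density of [mu] with
    respect to [nu], yields
    [KL mu nu >= int g dmu + 1 - int e^g dnu]; taking [g = a 1_A] and choosing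
    [a] proportional to [mu A - nu A] produces the square.

    In the reverse direction, [KL_le_TV]: if [mu <= c m] then
    [KL mu m <= c TV mu m], because [ln h <= (h - 1)^+] and the integral of
    [(h - 1)^+] against [m] is [mu B - m B] for [B = {h > 1}].  At a midpoint
    [m = (mu + nu) / 2] one has [mu <= 2 m] and [TV mu m <= TV mu nu / 2], so
    [KL mu m <= TV mu nu].

    Passing to suprema and infima, the first inequality bounds [set_TV] by a
    constant times the square root of [sym_KL], because both summands of
    [sym_KL] are nonnegative; the second gives [set_JS <= set_TV].  Hence (i)
    follows from the hypothesis, and (ii) follows from (i) by squeezing. *)

(** * Lower bounds on the divergence *)

Section divergence_inequalities.
Context d (T : measurableType d) (R : realType).
Implicit Types mu nu m : probability T R.
Local Open Scope ereal_scope.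

(** Positive and negative parts are compared separately, and the integral of a
    nonnegative function is a supremum over the simple functions below it.  The
    lemma thus applies to the logarithm of a density, whose integral may be
    infinite. *)
Lemma le_integral_pointwise (mu : {measure set T -> \bar R})
    (f g : T -> \bar R) :
  (forall x, f x <= g x) -> \int[mu]_x f x <= \int[mu]_x g x.
Proof.
move=> fg.
have ge0_le (f' g' : T -> \bar R) : (forall x, 0 <= f' x) ->
    (forall x, f' x <= g' x) -> \int[mu]_x f' x <= \int[mu]_x g' x.
  move=> f0 fg'; rewrite !ge0_integralTE//; last first.
    by move=> x; exact: le_trans (f0 x) (fg' x).
  apply: ge_ereal_sup => _ [h hf <-]; apply: ereal_sup_ubound.
  by exists h => // x; exact: le_trans (hf x) (fg' x).
rewrite integralE [leRHS]integralE leeB//; apply: ge0_le => // x.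
- by apply: (@funepos_le _ _ setT) => [y _|]; [exact: fg|rewrite inE].
- by apply: (@funeneg_le _ _ setT) => [y _|]; [exact: fg|rewrite inE].
Qed.

(** With [h] the density and [s = 1 / h], the tangent-line inequality
    [1 + u <= e^u] at [u = g - ln h] reads [g + 1 - e^g s <= ln h], and
    [e^g s] integrates to at most [int e^g dnu] because [s h <= 1]. *)
Lemma gibbs_variational_le_KL mu nu (g : T -> R) :
    mu.-integrable setT (EFin \o g) ->
    nu.-integrable setT (EFin \o (fun x => expR (g x))) ->
  \int[mu]_x (g x)%:E + 1 - \int[nu]_x (expR (g x))%:E <= KL mu nu.
Proof.
move=> ig ie; rewrite /KL; case: asboolP => [munu|_]; last exact: leey.
set h := Radon_Nikodym _ _.
have hfin x : h x \is a fin_num by exact: Radon_Nikodym_fin_num.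
have mh : measurable_fun setT h.
  exact/(measurable_int nu)/Radon_Nikodym_integrable.
(* The value +oo where [h <= 0] makes the pointwise bound hold everywhere, lne
   being -oo there; it costs nothing in the integral of [e^g s h] against
   [nu], as [h = 0] almost everywhere on that set and [+oo * 0 = 0]. *)
pose s x := if 0 < h x then (expR (- ln (fine (h x))))%:E else +oo.
have s0 x : 0 <= s x by rewrite /s; case: ifP => // _; rewrite lee_fin expR_ge0.
have ms : measurable_fun setT s.
  apply: measurable_fun_ifT => //; first exact: measurable_fun_lte.
  apply/measurable_EFinP; apply: measurableT_comp => //.
  apply: measurableT_comp => //; apply: measurableT_comp => //.
  exact: measurableT_comp.
have me : measurable_fun setT (EFin \o (fun x => expR (g x))).
  exact: measurable_int ie.
have mes : measurable_fun setT (fun x => (expR (g x))%:E * s x).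
  exact: emeasurable_funM.
have es_le : \int[mu]_x ((expR (g x))%:E * s x) <= \int[nu]_x (expR (g x))%:E.
  (* [f] is an everywhere nonnegative version of the density, as the change of
     variables for nonnegative integrands requires; [h] itself is nonnegative
     only almost everywhere. *)
  rewrite -(Radon_Nikodym_SigmaFinite.change_of_variables munu)//; last first.
    by move=> x; rewrite mule_ge0// lee_fin expR_ge0.
  set f := Radon_Nikodym_SigmaFinite.f _ _.
  have f0 x : 0 <= f x by exact: Radon_Nikodym_SigmaFinite.f_ge0.
  have mf : measurable_fun setT f.
    exact/(measurable_int nu)/Radon_Nikodym_SigmaFinite.f_integrable.
  apply: ae_ge0_le_integral => //.
    by move=> x _; rewrite !mule_ge0// lee_fin expR_ge0.
    exact: emeasurable_funM.
  have fh : ae_eq nu setT f h by exact: ae_eq_Radon_Nikodym_SigmaFinite.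
  apply: filterS fh => x /(_ Logic.I) fh _.
  rewrite -[leRHS]mule1 -muleA lee_wpmul2l ?lee_fin ?expR_ge0//.
  rewrite fh /s; case: ifPn => [h0|].
    rewrite -{2}(fineK (hfin x)) expRN.
    rewrite lnK ?posrE ?fine_gt0 ?h0 ?ltey_eq ?hfin//.
    by rewrite -EFinM mulVf// gt_eqF// fine_gt0// h0 ltey_eq hfin.
  rewrite -leNgt => h0; rewrite (_ : h x = 0) ?mule0//.
  by apply/le_anti; rewrite h0 -fh f0.
have ies : mu.-integrable setT (fun x => (expR (g x))%:E * s x).
  apply/integrableP; split => //.
  under eq_integral do rewrite gee0_abs ?mule_ge0 ?lee_fin ?expR_ge0//.
  apply: le_lt_trans es_le _; rewrite ltey_eq.
  by rewrite (integrable_fin_num measurableT ie).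
have i1 : mu.-integrable setT (cst 1) by exact: finite_measure_integrable_cst.
have ig1 : mu.-integrable setT (fun x => (g x)%:E + 1) by exact: integrableD.
apply: (@le_trans _ _ (\int[mu]_x ((g x)%:E + 1 - (expR (g x))%:E * s x))).
  rewrite integralB// integralD//.
  rewrite integral_cst// [X in 1 * X](@probability_setT _ _ _ mu) mule1.
  exact: leeB.
apply: le_integral_pointwise => x; rewrite /s; case: ifPn => [h0|_]; last first.
  by rewrite gt0_muley ?lte_fin ?expR_gt0//= leNye.
have r0 : (0 < fine (h x))%R by rewrite fine_gt0// h0 ltey_eq hfin.
rewrite -[in lne _](fineK (hfin x)) lne_EFin//.
rewrite -[leLHS]/((g x + 1 - expR (g x) * expR (- ln (fine (h x))))%R%:E).
rewrite -expRD lee_fin.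
by have := expR_ge1Dx (g x - ln (fine (h x)))%R; lra.
Qed.

(** The variational bound at [g = a 1_A], where [e^g = 1 + (e^a - 1) 1_A]. *)
Lemma event_le_KL mu nu (A : set T) (a : R) : measurable A ->
  (a * fine (mu A) - (expR a - 1) * fine (nu A))%:E <= KL mu nu.
Proof.
move=> mA; pose g x := (a * \1_A x)%R.
have gE : EFin \o g = (fun x => a%:E * (\1_A x)%:E) by apply/funext.
have eE : EFin \o (fun x => expR (g x)) =
    (fun x => 1 + (expR a - 1)%:E * (\1_A x)%:E).
  apply/funext => x /=; rewrite /g indicE.
  case: (x \in A); rewrite ?(mulr1, mulr0, expR0, mule1, mule0, adde0)//.
  by rewrite -EFinD addrC subrK.
have iA (m : probability T R) c :
    m.-integrable setT (fun x => c%:E * (\1_A x)%:E).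
  by apply: integrableZl => //; exact: integrable_indic.
have i1 (m : probability T R) : m.-integrable setT (cst 1).
  exact: finite_measure_integrable_cst.
have intA (m : probability T R) c :
    \int[m]_x (c%:E * (\1_A x)%:E) = (c * fine (m A))%:E.
  rewrite integralZl//; last exact: integrable_indic.
  by rewrite integral_indic// setIT EFinM fineK// fin_num_measure.
have int1 (m : probability T R) : \int[m]_x (cst 1 x) = 1.
  by rewrite integral_cst// [X in 1 * X](@probability_setT _ _ _ m) mule1.
have ig : mu.-integrable setT (EFin \o g) by rewrite gE.
have ie : nu.-integrable setT (EFin \o (fun x => expR (g x))).
  by rewrite eE; exact: (integrableD measurableT (i1 nu) (iA nu _)).
have := gibbs_variational_le_KL _ _ _ ig ie.
rewrite (_ : \int[mu]_x (g x)%:E = (a * fine (mu A))%:E); last first.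
  by rewrite -(intA mu a); apply: eq_integral => x _; rewrite -EFinM.
rewrite (_ : \int[nu]_x _ = 1 + ((expR a - 1) * fine (nu A))%:E); last first.
  rewrite -intA -[X in X + _](int1 nu).
  rewrite -(integralD measurableT (i1 nu) (iA nu _)).
  apply: eq_integral => x _; exact: (congr1 (@^~ x) eE).
apply: le_trans.
rewrite -[leRHS]/((a * fine (mu A) + 1 -
  (1 + (expR a - 1) * fine (nu A)))%R%:E) lee_fin.
lra.
Qed.

Lemma KL_ge0 mu nu : 0 <= KL mu nu.
Proof.
by have := event_le_KL mu nu _ 0 measurableT; rewrite expR0 subrr !mul0r subr0.
Qed.

(** From [1 - a <= e^-a] one gets [e^a <= 1 / (1 - a)], which is at most
    [1 + a + 2 a^2] as long as [a <= 1/2]. *)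
Lemma expR_sub1_le (a : R) :
  (0 <= a <= 1 / 2 -> expR a - 1 <= a + 2 * a ^+ 2)%R.
Proof.
move=> /andP[a0 a1].
have e1 : (expR a * (1 - a) <= 1)%R.
  rewrite -[leRHS](expRxMexpNx_1 a) ler_wpM2l ?expR_ge0//.
  by have := expR_ge1Dx (- a); lra.
rewrite lerBlDr -(@ler_pM2r _ (1 - a)); last lra.
by apply: le_trans e1 _; nra.
Qed.

Lemma fine_probability01 mu (A : set T) : measurable A ->
  (0 <= fine (mu A) <= 1)%R.
Proof.
move=> mA; rewrite fine_ge0//= -lee_fin fineK ?fin_num_measure//.
exact: probability_le1.
Qed.

(** With [t = mu A - nu A >= 0], the choice [a = t / 4] in [event_le_KL]
    gives at least [a t - 2 a^2 = t^2 / 8].  When [t < 0], the complement of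
    [A] has the opposite difference. *)
Lemma sqr_event_le_KL mu nu (A : set T) : measurable A ->
  ((fine (mu A) - fine (nu A)) ^+ 2 / 8)%:E <= KL mu nu.
Proof.
have half (B : set T) : measurable B -> (0 <= fine (mu B) - fine (nu B))%R ->
    ((fine (mu B) - fine (nu B)) ^+ 2 / 8)%:E <= KL mu nu.
  move=> mB t0; set t := (_ - _)%R in t0 *.
  apply: le_trans (event_le_KL _ _ _ (t / 4) mB).
  have /andP[q0 q1] := fine_probability01 nu B mB.
  have /andP[p0 p1] := fine_probability01 mu B mB.
  have a01 : (0 <= t / 4 <= 1 / 2)%R.
    by rewrite /t in t0 *; apply/andP; split; lra.
  have := ler_wpM2r q0 (expR_sub1_le _ a01).
  have : (0 <= t ^+ 2 * (1 - fine (nu B)))%R.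
    by rewrite mulr_ge0 ?sqr_ge0// subr_ge0.
  rewrite lee_fin; set x := (_ * fine (nu B))%R.
  by rewrite /t; lra.
move=> mA; have [/half|] := leP 0%R (fine (mu A) - fine (nu A))%R; first exact.
move=> t0.
have fC (m : probability T R) : fine (m (~` A)) = (1 - fine (m A))%R.
  by rewrite probability_setC// fineB// fin_num_measure.
have := half (~` A) (measurableC mA); rewrite !fC.
rewrite (_ : _ - _ = - (fine (mu A) - fine (nu A)))%R; last by lra.
by rewrite sqrrN; apply; lra.
Qed.

Lemma abse_subE mu nu (A : set T) : measurable A ->
  `|mu A - nu A| = `|fine (mu A) - fine (nu A)|%:E.
Proof. by move=> mA; rewrite -abse_EFin EFinB !fineK// fin_num_measure. Qed.

Lemma TV_le_of_KL_le mu nu (e : R) : (0 <= e)%R ->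
  KL mu nu <= (e ^+ 2 / 8)%:E -> TV mu nu <= e%:E.
Proof.
move=> e0 KLe; apply: ge_ereal_sup => _ [A mA <-].
have := le_trans (sqr_event_le_KL _ _ _ mA) KLe.
rewrite lee_fin ler_pM2r// -[leLHS]real_normK ?num_real// ler_sqr ?nnegrE//.
by rewrite abse_subE.
Qed.

Lemma TVC mu nu : TV mu nu = TV nu mu.
Proof.
by congr ereal_sup; apply: eq_imagel => A mA; rewrite !abse_subE// distrC.
Qed.

Lemma TV_ge0 mu nu : 0 <= TV mu nu.
Proof.
apply: le_trans (abse_ge0 (mu set0 - nu set0)) _.
by apply: ereal_sup_ubound; exists set0.
Qed.

(** * Upper bounds on the divergence *)

(** A reverse Pinsker inequality.  Since [ln h <= (h - 1)^+] and [mu <= c m],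
    the divergence is at most [c] times the [m]-integral of [(h - 1)^+], which
    is [mu B - m B] for the event [B = {h > 1}]. *)
Lemma KL_le_TV mu m (c : R) : (0 <= c)%R ->
    (forall A, measurable A -> mu A <= c%:E * m A) ->
  KL mu m <= c%:E * TV mu m.
Proof.
move=> c0 muc.
have mum : mu `<< m.
  move=> N N0 A mA AN; apply/eqP; rewrite eq_le measure_ge0 andbT.
  by rewrite (le_trans (muc _ mA))// N0// mule0.
rewrite /KL; case: asboolP => // _; set h := Radon_Nikodym _ _.
have hfin x : h x \is a fin_num by exact: Radon_Nikodym_fin_num.
have mh : measurable_fun setT h.
  exact/(measurable_int m)/Radon_Nikodym_integrable.
pose B := [set x | 1 < h x].
have mB : measurable B.
  by rewrite -[B]setTI; exact: emeasurable_fun_o_infty.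
pose k x := maxe (h x - 1) 0.
have mk : measurable_fun setT k.
  apply: measurable_maxe => //; apply: emeasurable_funB => //.
have k0 x : 0 <= k x by rewrite le_max lexx orbT.
have ih : m.-integrable setT h by exact: Radon_Nikodym_integrable.
have intk : \int[m]_x k x = mu B - m B.
  rewrite (_ : k = (fun x => h x - 1) \_ B).
    rewrite -integral_mkcond integralB//.
    - by rewrite -Radon_Nikodym_integral// integral_cst// mul1e.
    - exact: integrableS ih.
    - exact: finite_measure_integrable_cst.
  apply/funext => x; rewrite /k patchE; case: ifPn => [/set_mem hB|/negP hB].
    by apply/max_idPl; rewrite sube_ge0// ltW.
  by apply/max_idPr; rewrite sube_le0 leNgt; apply/negP => h1; exact/hB/mem_set.
apply: (@le_trans _ _ (\int[mu]_x k x)).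
  apply: le_integral_pointwise => x; rewrite /k -(fineK (hfin x)).
  set r := fine _.
  rewrite le_max; have [r0|r0] := leP r 0%R; first by rewrite le0_lneNy ?leNye.
  rewrite lne_EFin// -EFinB !lee_fin; apply/orP; left.
  by have := @le_ln1Dx _ (r - 1)%R; rewrite (addrC 1%R) subrK; apply; lra.
apply: (@le_trans _ _ (c%:E * \int[m]_x k x)).
  pose c' := NngNum c0.
  rewrite -(ge0_integral_mscale _ _ c')//.
  by apply: ge0_le_measure_integral => // A mA; exact: muc.
rewrite lee_wpmul2l ?lee_fin// intk; apply: le_trans (lee_abs _) _.
by apply: ereal_sup_ubound; exists B.
Qed.

(** The reverse Pinsker inequality with [c = 2]: the factor cancels against
    [TV mu m <= TV mu nu / 2].  The measure [m] is given by its values so that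
    the lemma applies to [mixture] with the arguments in either order. *)
Lemma KL_midpoint_le_TV mu nu m :
    (forall A, measurable A -> m A = (2^-1)%:E * (mu A + nu A)) ->
  KL mu m <= TV mu nu.
Proof.
move=> mE.
have fmE A : measurable A -> fine (m A) = ((fine (mu A) + fine (nu A)) / 2)%R.
  by move=> mA; rewrite mE// fineM ?fineD ?fin_numD ?fin_num_measure//= mulrC.
have mule2K (x : \bar R) : 2%:E * ((2^-1)%:E * x) = x.
  by rewrite muleA -EFinM divff// mul1e.
rewrite -[leRHS]mule2K; apply: (@le_trans _ _ (2%:E * TV mu m)).
  apply: KL_le_TV => // A mA; rewrite mE// mule2K.
  by rewrite leeDl.
rewrite lee_wpmul2l ?lee_fin//; apply: ge_ereal_sup => _ [A mA <-].
apply: (@le_trans _ _ ((2^-1)%:E * `|mu A - nu A|)).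
  rewrite !abse_subE// fmE// -EFinM lee_fin.
  rewrite (_ : _ - _ / 2 = 2^-1 * (fine (mu A) - fine (nu A)))%R; last by lra.
  by rewrite normrM ger0_norm ?invr_ge0.
by rewrite lee_wpmul2l ?lee_fin ?invr_ge0//; apply: ereal_sup_ubound; exists A.
Qed.

Lemma mixture_halfE mu nu A :
  mixture (half01 R) mu nu A = (2^-1)%:E * (mu A + nu A).
Proof.
rewrite /mixture/= ge0_muleDr//; congr (_ + _ * _); congr EFin.
by lra.
Qed.

(** * Divergences between sets of measures *)

Implicit Types P Q : set (probability T R).

(** Nonnegativity of both summands is what makes each of them small when
    [sym_KL] is; over an empty [P] the supremum is -oo. *)
Lemma set_KL_ge0 P Q : P !=set0 -> 0 <= set_KL P Q.
Proof.
move=> [mu Pmu]; apply: le_ereal_sup_tmp.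
exists (ereal_inf [set KL mu nu | nu in Q]); first by exists mu.
by apply: le_ereal_inf_tmp => _ [nu _ <-]; exact: KL_ge0.
Qed.

Lemma set_KL_ex P Q mu (x : \bar R) : P mu -> set_KL P Q < x ->
  exists2 nu, Q nu & KL mu nu < x.
Proof.
move=> Pmu PQ; have : ereal_inf [set KL mu nu | nu in Q] < x.
  by apply: le_lt_trans PQ; apply: ereal_sup_ubound; exists mu.
by move=> /ereal_inf_lt[_ [nu Qnu <-]]; exists nu.
Qed.

(** Strictness of the hypothesis yields, for each measure of one set, a measure
    of the other at small divergence, even if the infimum is not attained. *)
Lemma set_TV_le P Q (e : R) : (0 <= e)%R -> P !=set0 -> Q !=set0 ->
  sym_KL P Q < (e ^+ 2 / 8)%:E -> set_TV P Q <= e%:E.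
Proof.
move=> e0 P0 Q0 PQ; rewrite /set_TV ge_max; apply/andP; split.
  have PQ' : set_KL P Q < (e ^+ 2 / 8)%:E.
    by apply: le_lt_trans PQ; rewrite leeDl// set_KL_ge0.
  apply: ge_ereal_sup => _ [mu Pmu <-].
  have [nu Qnu munu] := set_KL_ex _ _ _ _ Pmu PQ'.
  by apply: ge_ereal_inf; exists (TV mu nu);
    [exists nu|exact/TV_le_of_KL_le/ltW].
have QP : set_KL Q P < (e ^+ 2 / 8)%:E.
  by apply: le_lt_trans PQ; rewrite leeDr// set_KL_ge0.
apply: ge_ereal_sup => _ [nu Qnu <-].
have [mu Pmu numu] := set_KL_ex _ _ _ _ Qnu QP.
by apply: ge_ereal_inf; exists (TV mu nu);
  [exists mu|rewrite TVC; exact/TV_le_of_KL_le/ltW].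
Qed.

Lemma set_TV_ge0 P Q : P !=set0 -> 0 <= set_TV P Q.
Proof.
move=> [mu Pmu]; rewrite /set_TV le_max; apply/orP; left.
apply: le_ereal_sup_tmp.
exists (ereal_inf [set TV mu nu | nu in Q]); first by exists mu.
by apply: le_ereal_inf_tmp => _ [nu _ <-]; exact: TV_ge0.
Qed.

Lemma set_JS_ge0 P Q : P !=set0 -> Q !=set0 -> 0 <= set_JS P Q.
Proof.
by move=> P0 Q0; rewrite adde_ge0// mule_ge0// ?lee_fin ?invr_ge0// set_KL_ge0.
Qed.

(** Each of the two directed divergences to the midpoints is dominated by the
    corresponding directed variation, by comparing, for fixed [mu], the
    midpoint of [mu] and [nu] with [nu]; an average is at most the maximum. *)
Lemma set_JS_le_set_TV P Q : set_JS P Q <= set_TV P Q.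
Proof.
have half_ge0 : (0 <= 2^-1 :> R)%R by rewrite invr_ge0.
have -> : set_TV P Q = (2^-1)%:E * set_TV P Q + (2^-1)%:E * set_TV P Q.
  rewrite -ge0_muleDl ?lee_fin// -EFinD (_ : (2^-1 + 2^-1 = 1 :> R)%R) ?mul1e//.
  by lra.
rewrite /set_JS leeD// lee_wpmul2l ?lee_fin// /set_TV le_max; apply/orP.
- left; apply: ge_ereal_sup => _ [mu Pmu <-]; apply: le_ereal_sup_tmp.
  exists (ereal_inf [set TV mu nu | nu in Q]); first by exists mu.
  apply: le_ereal_inf_tmp => _ [nu Qnu <-]; apply: ge_ereal_inf.
  exists (KL mu (mixture (half01 R) mu nu)).
    by exists (mixture (half01 R) mu nu) => //; exists mu => //; exists nu.
  by apply: KL_midpoint_le_TV => A mA; exact: mixture_halfE.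
- right; apply: ge_ereal_sup => _ [nu Qnu <-]; apply: le_ereal_sup_tmp.
  exists (ereal_inf [set TV mu nu | mu in P]); first by exists nu.
  apply: le_ereal_inf_tmp => _ [mu Pmu <-]; apply: ge_ereal_inf.
  exists (KL nu (mixture (half01 R) mu nu)).
    by exists (mixture (half01 R) mu nu) => //; exists mu => //; exists nu.
  rewrite TVC; apply: KL_midpoint_le_TV => A mA.
  by rewrite addeC; exact: mixture_halfE.
Qed.

End divergence_inequalities.

(** * Convergence *)

Lemma cvge0_of_eventually_le (R : realType) (f : nat -> \bar R) :
    (\forall n \near \oo, 0%E <= f n)%E ->
    (forall e : R, 0 < e -> \forall n \near \oo, (f n <= e%:E)%E) ->
  f n @[n --> \oo] --> 0%E.
Proof.
move=> f0 fe; apply/fine_cvgP; split.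
  near=> n; rewrite fin_real//; apply/andP; split.
    by apply: (@lt_le_trans _ _ 0%E); [exact: ltNyr|near: n].
  by apply: (@le_lt_trans _ _ 1%E); [near: n; exact: fe|exact: ltry].
apply/cvgrPdist_le => e e0; near=> n.
have fn0 : (0 <= f n)%E by near: n.
have fne : (f n <= e%:E)%E by near: n; exact: fe.
have ffin : f n \is a fin_num.
  by rewrite ge0_fin_numE// (le_lt_trans fne)// ltry.
by rewrite /= sub0r normrN ger0_norm ?fine_ge0// -lee_fin fineK.
Unshelve. all: by end_near. Qed.

Theorem theorem7 (R : realType) (X : ptopologicalType) (polishX : polish R X)
    (P : set (probability (borel X) R))
    (Pn : nat -> set (probability (borel X) R))
    (P_nonempty : P !=set0) (P_compact : weakly_compact P)
    (P_convex : convex_probabilities P)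
    (Pn_nonempty : forall n, (1 <= n)%N -> Pn n !=set0)
    (Pn_compact : forall n, (1 <= n)%N -> weakly_compact (Pn n))
    (Pn_convex : forall n, (1 <= n)%N -> convex_probabilities (Pn n)) :
  sym_KL (Pn n) P @[n --> \oo] --> 0%E ->
  (set_TV (Pn n) P @[n --> \oo] --> 0%E) /\
  (set_JS (Pn n) P @[n --> \oo] --> 0%E).
Proof.
move=> KL0.
have n1 : \forall n \near \oo, (1 <= n)%N by exact: nbhs_infty_ge.
have TV0 : set_TV (Pn n) P @[n --> \oo] --> 0%E.
  apply: cvge0_of_eventually_le.
    by apply: filterS n1 => n /Pn_nonempty; exact: set_TV_ge0.
  move=> e e0.
  have KLe : \forall n \near \oo, (sym_KL (Pn n) P < (e ^+ 2 / 8)%:E)%E.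
    apply: (KL0 [set x | x < (e ^+ 2 / 8)%:E]%E).
    apply: open_nbhs_nbhs; split; first exact: open_ereal_lt_ereal.
    by rewrite /= lte_fin divr_gt0// exprn_gt0.
  apply: filterS2 n1 KLe => n /Pn_nonempty Pn0 KLn.
  exact: set_TV_le (ltW e0) Pn0 P_nonempty KLn.
split=> //.
apply: (@squeeze_cvge _ _ _ _ (cst 0%E) _ (fun n => set_TV (Pn n) P)) => //.
- apply: filterS n1 => n /Pn_nonempty Pn0; apply/andP; split.
    exact: set_JS_ge0.
  exact: set_JS_le_set_TV.
- exact: cvg_cst.
Qed.
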